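(* For each integer $s\ge 1$, if $n\ge \operatorname{Ram}(3,4;s^2)$, then $\operatorname{ldim}(1,2;n)>s$.
   Context: For integers $2\le d<n$, $P(1,d;n)$ is the poset consisting of all $1$-element and all $d$-element subsets of $\{1,\dots,n\}$ ordered by inclusion, and $\operatorname{ldim}(1,d;n)$ denotes its local dimension. $\operatorname{Ram}(k,h;r)$ denotes the least positive integer $N$ such that for every $n\ge N$ and every coloring of the $k$-element subsets of $\{1,\dots,n\}$ with $r$ colors there is an $h$-element subset all of whose $k$-element subsets receive the same color. A partial linear extension (ple) of a poset $P$ is a linear extension of a subposet of $P$. For a family $\mathcal{L}$ of ple's, $\mu(u,\mathcal{L})$ is the number of members containing $u$ and $\mu(\mathcal{L})=\max_u\mu(u,\mathcal{L})$. A non-empty family $\mathcal{L}$ is a local realizer of $P$ if (1) whenever $x\le y$ in $P$ some $L\in\mathcal{L}$ has $x\le y$ in $L$, and (2) whenever $x\parallel y$ in $P$ some $L\in\mathcal{L}$ has $x>y$ in $L$. The local dimension of $P$ is the minimum of $\mu(\mathcal{L})$ over local realizers $\mathcal{L}$. *)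

(* Defs.v *)
From HB Require Import structures.
From mathcomp Require Import all_boot all_order.
From mathcomp Require Import boolp.

Set Implicit Arguments.
Unset Strict Implicit.
Unset Printing Implicit Defensive.

Import Order.Theory.

Section LocalDimension.

Context {d : Order.disp_t} {T : finPOrderType d}.

(* The values of [ple_le] outside [ple_dom] are irrelevant.  Reflexivity on
   [ple_dom] follows from [ple_ext]. *)
Record ple := Ple {
  ple_dom : {set T};
  ple_le : rel T;
  ple_ext : {in ple_dom &, forall x y, (x <= y)%O -> ple_le x y};
  ple_anti : {in ple_dom &, antisymmetric ple_le};
  ple_trans : {in ple_dom & &, transitive ple_le};
  ple_total : {in ple_dom &, total ple_le}
}.

Definition le_in (L : ple) (x y : T) : bool :=
  [&& x \in ple_dom L, y \in ple_dom L & ple_le L x y].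

Definition lt_in (L : ple) (x y : T) : bool := (x != y) && le_in L x y.

(* Families are indexed, so that repetitions are allowed. *)
Definition mult (I : finType) (F : I -> ple) (u : T) : nat :=
  #|[set i | u \in ple_dom (F i)]|.

Definition max_mult (I : finType) (F : I -> ple) : nat :=
  \max_(u : T) mult F u.

Definition local_realizer (I : finType) (F : I -> ple) : Prop :=
  [/\ 0 < #|I|,
      forall x y : T, (x <= y)%O -> exists i, le_in (F i) x y
    & forall x y : T, (x >< y)%O -> exists i, lt_in (F i) y x].

Definition ldim_attained (k : nat) : Prop :=
  exists m (F : 'I_m -> ple), local_realizer F /\ max_mult F = k.

Section Pairs.
Variables (x y : T) (nyx : ~~ (y < x)%O).

Let dom := [set x; y].
Let le : rel T := fun a b => (a == x) || (b == y).

Fact pair_ext : {in dom &, forall a b, (a <= b)%O -> le a b}.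
Proof.
move=> a b /set2P[] -> /set2P[] -> ab; rewrite /le ?eqxx ?orbT //.
by move: nyx; rewrite lt_neqAle ab andbT negbK => ->.
Qed.

Fact pair_anti : {in dom &, antisymmetric le}.
Proof.
move=> a b /set2P[] -> /set2P[] -> //; rewrite /le !eqxx ?orbT ?andbT /=;
  by case/orP => /eqP.
Qed.

Fact pair_trans : {in dom & &, transitive le}.
Proof.
move=> b a c /set2P[] -> /set2P[] -> /set2P[] ->; rewrite /le !eqxx ?orbT //=;
  by move=> // + /eqP->; rewrite ?eqxx ?orbT.
Qed.

Fact pair_total : {in dom &, total le}.
Proof. by move=> a b /set2P[] -> /set2P[] ->; rewrite /le !eqxx ?orbT. Qed.

Definition pair_ple : ple := Ple pair_ext pair_anti pair_trans pair_total.

Lemma pair_pleE : le_in pair_ple x y.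
Proof. by rewrite /le_in /= !inE /le !eqxx orbT. Qed.

End Pairs.

Definition empty_ple : ple.
Proof.
by apply: (@Ple set0 (fun _ _ => true)); move=> ?; rewrite inE.
Defined.

Lemma ldim_attained_ex : exists k, `[< ldim_attained k >].
Proof.
pose I : finType := option {p : T * T | ~~ (p.2 < p.1)%O}.
pose F (i : I) := if i is Some p then pair_ple (valP p) else empty_ple.
pose G (j : 'I_#|I|) := F (enum_val j).
have GF x y (h : ~~ (y < x)%O) : exists j, le_in (G j) x y.
  exists (enum_rank (Some (exist (fun p => ~~ (p.2 < p.1)%O) (x, y) h) : I)).
  by rewrite /G enum_rankK; apply: pair_pleE.
exists (max_mult G); apply/asboolP; exists #|I|, G; split=> //; split.
- by rewrite card_ord card_option.
- by move=> x y xy; apply: GF; rewrite le_gtF.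
- move=> x y xy; have [|j jP] := GF y x; first by rewrite incomparable_ltF.
  by exists j; rewrite /lt_in jP andbT; apply: contraNneq xy => ->; apply: comparablexx.
Qed.

End LocalDimension.

Arguments ple {d} T.

(* Only finite families are considered: as [T] is finite, a family with bounded
   multiplicities has finitely many nonempty members. *)
Definition ldim {d} (T : finPOrderType d) : nat :=
  ex_minn (@ldim_attained_ex d T).

(* P(1,d;n), with ground set {0, ..., n-1} *)
Record layers (d n : nat) := Layers {
  layer_set :> {set 'I_n};
  layer_setP : (#|layer_set| == 1) || (#|layer_set| == d)
}.

Section LayersOrder.
Variables d n : nat.
HB.instance Definition _ := [isSub for @layer_set d n].
HB.instance Definition _ := [Finite of layers d n by <:].

Let incl (A B : layers d n) : bool := layer_set A \subset layer_set B.
Fact incl_refl : reflexive incl. Proof. by move=> A; apply: subxx. Qed.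
Fact incl_anti : antisymmetric incl.
Proof. by move=> A B AB; apply/val_inj/eqP; rewrite eqEsubset. Qed.
Fact incl_trans : transitive incl.
Proof. by move=> B A C; apply: subset_trans. Qed.
HB.instance Definition _ :=
  Order.Le_isPOrder.Build (Order.Disp tt tt) (layers d n)
    incl_refl incl_anti incl_trans.
End LayersOrder.

Lemma layers_leE (d n : nat) (A B : layers d n) :
  (A <= B)%O = (layer_set A \subset layer_set B).
Proof. by []. Qed.

Definition ldim1 (d n : nat) : nat := ldim (layers d n).

(* Colors are 0, ..., r-1; the values of [c] outside the k-sets are irrelevant. *)
Definition ramsey_at (k h r n : nat) : Prop :=
  forall c : {set 'I_n} -> nat,
    (forall A : {set 'I_n}, #|A| = k -> c A < r) ->
  exists H : {set 'I_n}, #|H| = h /\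
    forall A B : {set 'I_n}, A \subset H -> B \subset H ->
      #|A| = k -> #|B| = k -> c A = c B.

Definition ramsey_bound (k h r N : nat) : Prop :=
  0 < N /\ forall n, N <= n -> ramsey_at k h r n.

Section RamseyTheorem.

Lemma subset_of_card (T : finType) (X : {set T}) h : h <= #|X| ->
  exists H : {set T}, H \subset X /\ #|H| = h.
Proof.
move=> hX; exists [set x in take h (enum X)]; split.
  by apply/subsetP => x; rewrite inE => /mem_take; rewrite mem_enum.
rewrite cardsE (card_uniqP _) ?take_uniq ?enum_uniq //.
by rewrite size_takel // -cardE.
Qed.

(* [s] is end-homogeneous: the color of a k.+1-set depends only on its first
   element in [s]. *)
Fixpoint end_hom (T : finType) (C : Type) (k : nat) (c : {set T} -> C)
    (g : T -> C) (s : seq T) : Prop :=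
  if s is x :: s' then
    (forall A : {set T}, A \subset [set y in s'] -> #|A| = k ->
       c (x |: A) = g x) /\ end_hom k c g s'
  else True.

Lemma end_homP (T : finType) C k (c : {set T} -> C) g s (A : {set T}) :
  end_hom k c g s -> A \subset [set y in s] -> #|A| = k.+1 ->
  exists2 x, x \in A & c A = g x.
Proof.
elim: s => [_|x s IH /= [hx /IH {}IH]] sA cA.
  have: A \subset set0.
    by apply: subset_trans sA _; apply/subsetP => y; rewrite !inE.
  by rewrite subset0 => /eqP A0; rewrite A0 cards0 in cA.
have sub y : y \in A -> y != x -> y \in s.
  by move=> /(subsetP sA); rewrite !inE => /predU1P[->|//]; rewrite eqxx.
have [xA|xA] := boolP (x \in A).
  exists x => //; rewrite -{1}(setD1K xA); apply: hx.
    by apply/subsetP => y; rewrite !inE => /andP[yx yA]; apply: sub.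
  by move: (cardsD1 x A); rewrite xA cA => -[].
apply: IH => //; apply/subsetP => y yA; rewrite inE; apply: sub => //.
by apply: contraNneq xA => <-.
Qed.

Lemma eq_end_hom (T : finType) C k (c : {set T} -> C) g g' s :
  {in s, g =1 g'} -> end_hom k c g s -> end_hom k c g' s.
Proof.
elim: s => //= x s IH gg' [hx hs]; split.
  by move=> A sA cA; rewrite -gg' ?mem_head //; apply: hx.
by apply: IH hs => y ys; apply: gg'; rewrite inE ys orbT.
Qed.

Lemma ramsey_core (r k : nat) : forall h : nat, exists N : nat,
  forall (T : finType) (X : {set T}) (c : {set T} -> 'I_r.+1), N <= #|X| ->
  exists (H : {set T}) (a : 'I_r.+1), [/\ H \subset X, #|H| = h
    & forall A : {set T}, A \subset H -> #|A| = k -> c A = a].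
Proof.
elim: k => [|k IHk] h.
  exists h => T X c /subset_of_card[H [HX cH]]; exists H, (c set0); split=> //.
  by move=> A _ /eqP; rewrite cards_eq0 => /eqP->.
have seqs m : exists N : nat,
    forall (T : finType) (X : {set T}) (c : {set T} -> 'I_r.+1), N <= #|X| ->
    exists (s : seq T) g, [/\ uniq s, size s = m, [set y in s] \subset X
                            & end_hom k c g s].
  elim: m => [|m [M IHm]].
    exists 0 => T X c _; exists [::], (fun=> ord0); split=> //.
    by apply/subsetP => y; rewrite inE.
  have [N hN] := IHk M; exists N.+1 => T X c NX.
  have /card_gt0P[x xX] : 0 < #|X| by apply: leq_trans NX.
  have NX' : N <= #|X :\ x| by move: NX; rewrite (cardsD1 x) xX.
  have [Y [a [YX cY aY]]] := hN T (X :\ x) (fun A => c (x |: A)) NX'.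
  have [|s [g [us ss sY hs]]] := IHm T Y c; first by rewrite cY.
  have xs : x \notin s.
    apply/negP => xs; have: x \in X :\ x.
      by apply: (subsetP YX); apply: (subsetP sY); rewrite inE.
    by rewrite !inE eqxx.
  exists (x :: s), (fun y => if y == x then a else g y); split=> /=.
  - by rewrite xs.
  - by rewrite ss.
  - apply/subsetP => y; rewrite !inE => /predU1P[->//|ys].
    have: y \in X :\ x.
      by apply: (subsetP YX); apply: (subsetP sY); rewrite inE.
    by rewrite inE => /andP[].
  - split; first by move=> A sA cA; rewrite eqxx; exact: aY (subset_trans sA sY) cA.
    suff gg : {in s, g =1 fun y => if y == x then a else g y}.
      exact: eq_end_hom gg hs.
    by move=> y ys; case: eqP => // yx; rewrite -yx ys in xs.
have [N hN] := seqs (r.+1 * h); exists N => T X c NX.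
have [s [g [us ss sX hs]]] := hN T X c NX.
pose K a := [set y in s | g y == a].
have [a ha] : exists a, h <= #|K a|.
  apply/existsP; apply: contraT; rewrite negb_exists => /forallP small.
  have : r.+1 * h < r.+1 * h; last by rewrite ltnn.
  rewrite -{1}ss -(card_uniqP us) -sum1_card (partition_big g predT) //=.
  rewrite -[X in _ < X * _](card_ord r.+1) -sum_nat_const.
  have E a : \sum_(i in s | g i == a) 1 = #|K a|.
    by rewrite -sum1_card; apply: eq_bigl => y; rewrite inE.
  under eq_bigr do rewrite E.
  have lt a : #|K a| < h by rewrite ltnNge small.
  rewrite (bigD1 ord0) //= [X in _ < X](bigD1 ord0) //= -addSn.
  by apply: leq_add => //; apply: leq_sum => a _; apply: ltnW.
have [H [HK cH]] := subset_of_card ha.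
have Ks : K a \subset [set y in s].
  by apply/subsetP => y; rewrite !inE => /andP[].
exists H, a; split=> //; first exact: subset_trans HK (subset_trans Ks sX).
move=> A AH cA.
have [||x xA ->] := end_homP hs (A := A) => //.
  exact: subset_trans AH (subset_trans HK Ks).
have := subsetP (subset_trans AH HK) _ xA.
by rewrite inE => /andP[_ /eqP].
Qed.

Lemma ramsey_bound_ex (k h r : nat) : exists N, `[< ramsey_bound k h r N >].
Proof.
case: r => [|r].
  exists k.+1; apply/asboolP; split=> // n kn c hc.
  have [|A [_ cA]] := @subset_of_card 'I_n setT k.
    by rewrite cardsT card_ord ltnW.
  by have := hc A cA.
have [N hN] := ramsey_core r k h.
exists N.+1; apply/asboolP; split=> // n Nn c hc.
have [|H [a [_ cH aH]]] := hN 'I_n setT (fun A => inord (c A)).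
  by rewrite cardsT card_ord ltnW.
exists H; split=> // A B AH BH cA cB.
by rewrite -(inordK (hc A cA)) -(inordK (hc B cB)) (aH A) // (aH B).
Qed.

End RamseyTheorem.

Definition Ram (k h r : nat) : nat := ex_minn (ramsey_bound_ex k h r).

(* Main.v *)
(** Suppose a local realizer has all multiplicities at most s. For a < b < c the
    element b is incomparable to the pair {a,c}, so b > {a,c} in some member of
    the family; colour the triple by the position of that member among those
    containing b and its position among those containing {a,c}. On a homogeneous
    set a < b < c < d, the triples abc, abd share b, abd, acd share {a,d}, and
    acd, bcd share c, so all four use the same member L. In L we get the cycle
    c <= {a,c} < b <= {b,d} < c. *)

Require Import Defs.
From mathcomp Require Import all_boot all_order.
From mathcomp Require Import boolp.

Set Implicit Arguments.
Unset Strict Implicit.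
Unset Printing Implicit Defensive.

Lemma sorted_enum_ord n (A : {set 'I_n}) : sorted ltn (map val (enum A)).
Proof.
rewrite sorted_map /enum_mem; apply: sorted_filter.
  by move=> y x z; apply: ltn_trans.
by rewrite -sorted_map -enumT val_enum_ord iota_ltn_sorted.
Qed.

(** Strictly increasing lists with the same elements coincide; this lets a colour defined on sets be
    read off from an increasing triple. *)
Lemma enum_set_sorted n (s : seq 'I_n) :
  sorted ltn (map val s) -> enum [set x in s] = s.
Proof.
move=> ss; apply: (inj_map val_inj); apply: (irr_sorted_eq ltn_trans ltnn).
- exact: sorted_enum_ord.
- exact: ss.
- by apply: eq_mem_map => x; rewrite mem_enum inE.
Qed.

Lemma card_singleton n (b : 'I_n) : (#|[set b]| == 1) || (#|[set b]| == 2).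
Proof. by rewrite cards1. Qed.

Lemma card_doubleton n (a c : 'I_n) : (#|[set a; c]| == 1) || (#|[set a; c]| == 2).
Proof. by rewrite cards2; case: (a != c). Qed.

Definition singleton n (b : 'I_n) : layers 2 n := Layers (card_singleton b).
(* Total: for a = c this is the singleton of a. *)
Definition doubleton n (a c : 'I_n) : layers 2 n := Layers (card_doubleton a c).

Lemma singleton_le_doubletonl n (a c : 'I_n) : (singleton a <= doubleton a c)%O.
Proof. by rewrite layers_leE sub1set set21. Qed.

Lemma singleton_le_doubletonr n (a c : 'I_n) : (singleton c <= doubleton a c)%O.
Proof. by rewrite layers_leE sub1set set22. Qed.

Lemma singleton_incomp_doubleton n (a b c : 'I_n) : a < b < c ->
  (singleton b >< doubleton a c)%O.
Proof.
case/andP=> ab bc; rewrite /Order.comparable negb_or !layers_leE /=.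
rewrite sub1set !inE negb_or -!val_eqE /= gtn_eqF // ltn_eqF //=.
apply/negP => /subsetP/(_ a); rewrite !inE eqxx => /(_ isT).
by rewrite -val_eqE /= ltn_eqF.
Qed.

Section Positions.
Context {d : Order.disp_t} {T : finPOrderType d} (I : finType) (F : I -> ple T).

(** Numbering only the members that contain [u] bounds the positions by the multiplicity, however
    large the family is. *)
Definition position (u : T) (i : I) : nat :=
  index i (enum [set j | u \in ple_dom (F j)]).

Lemma position_lt (u : T) (i : I) : u \in ple_dom (F i) ->
  position u i < max_mult F.
Proof.
move=> ui; apply: leq_trans (leq_bigmax u).
by rewrite /mult cardE index_mem mem_enum inE.
Qed.

(** An index below the length certifies membership, so [j] inherits it from [i]. *)
Lemma position_inj (u : T) (i j : I) :
  u \in ple_dom (F i) -> position u i = position u j -> i = j.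
Proof.
move=> ui e; apply: (index_inj i _ _ e); last rewrite -index_mem -[index _ _]e index_mem;
  by rewrite mem_enum inE.
Qed.

End Positions.

(** Division with remainder by [s] recovers both components, so one colour can encode a pair of
    positions. *)
Lemma mul_add_inj s p q p' q' : q < s -> q' < s ->
  p * s + q = p' * s + q' -> p = p' /\ q = q'.
Proof.
move=> qs q's e; have s0 : 0 < s by apply: leq_ltn_trans qs.
split; last by move: (congr1 (modn^~ s) e); rewrite !modnMDl !modn_small.
move: (congr1 (divn^~ s) e).
by rewrite !divnMDl // !divn_small // !addn0.
Qed.

(** The strict relations place all four elements in [L], so [L] extends the two poset relations as
    well, and the cycle contradicts antisymmetry. *)
Lemma ple_cycleF d (T : finPOrderType d) (L : ple T) (x p y q : T) :
  (x <= p)%O -> (y <= q)%O -> lt_in L p y -> lt_in L q x -> False.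
Proof.
move=> xp yq /and4P[py pL yL lpy] /and4P[qx qL xL lqx].
have lxp := ple_ext xL pL xp; have lyq := ple_ext yL qL yq.
have lyx := ple_trans qL yL xL lyq lqx.
by move/eqP: py; apply; apply: (ple_anti pL yL); rewrite lpy (ple_trans xL).
Qed.

Lemma max_mult_ramsey s n (I : finType) (F : I -> ple (layers 2 n)) :
  ramsey_at 3 4 (s ^ 2) n -> local_realizer F -> s < max_mult F.
Proof.
move=> ram [I0 _ Finc]; rewrite ltnNge; apply/negP => Fs.
have [i0 _] := card_gt0P I0.
(* The default [i0] never matters for a < b < c, where the realizer supplies a member. *)
pose w a b c := odflt i0 [pick i | lt_in (F i) (doubleton a c) (singleton b)].
have wP (a b c : 'I_n) : a < b < c -> lt_in (F (w a b c)) (doubleton a c) (singleton b).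
  move=> /singleton_incomp_doubleton/Finc[i ilt]; rewrite /w; case: pickP => //=.
  by move/(_ i); rewrite ilt.
pose col a b c := position F (singleton b) (w a b c) * s
                  + position F (doubleton a c) (w a b c).
(* [enum] lists ordinals increasingly, so the match on a 3-set yields a < b < c. *)
pose C (A : {set 'I_n}) := if enum A is [:: a; b; c] then col a b c else 0.
have posP (a b c : 'I_n) : a < b < c -> [/\ singleton b \in ple_dom (F (w a b c)),
    doubleton a c \in ple_dom (F (w a b c)),
    position F (singleton b) (w a b c) < s & position F (doubleton a c) (w a b c) < s].
  case/wP/and4P=> _ pL bL _; split=> //;
  by apply: leq_trans (position_lt _) Fs.
have CE (a b c : 'I_n) : a < b < c -> C [set x in [:: a; b; c]] = col a b c.
  by case/andP=> ab bc; rewrite /C enum_set_sorted //= ab bc.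
have col_eq (a b c a' b' c' : 'I_n) : a < b < c -> a' < b' < c' ->
    col a b c = col a' b' c' ->
    position F (singleton b) (w a b c) = position F (singleton b') (w a' b' c') /\
    position F (doubleton a c) (w a b c) = position F (doubleton a' c') (w a' b' c').
  by move=> /posP[_ _ _ ?] /posP[_ _ _ ?]; apply: mul_add_inj.
have [A A3|H [H4 homH]] := ram C.
  rewrite /C; have := sorted_enum_ord A; move: A3; rewrite cardE.
  case: (enum A) => [|a [|b [|c []]]] //= _ /and3P[ab bc _].
  have abc : a < b < c by rewrite ab.
  have [_ _ ps qs] := posP _ _ _ abc.
  (* With both positions p, q below s: p * s + q < (p + 1) * s <= s * s. *)
  apply: (@leq_trans ((position F (singleton b) (w a b c)).+1 * s)).
    by rewrite mulSn [s + _]addnC ltn_add2l.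
  by rewrite -mulnn leq_mul2r ps orbT.
have sH := sorted_enum_ord H; move: H4; rewrite cardE.
case eH: (enum H) sH => [|a [|b [|c [|d []]]]] //= /and4P[ab bc cd _] _.
have ac := ltn_trans ab bc; have bd := ltn_trans bc cd.
have sub x y z : x \in enum H -> y \in enum H -> z \in enum H ->
    [set t in [:: x; y; z]] \subset H.
  rewrite !mem_enum => xH yH zH; apply/subsetP => t; rewrite !inE.
  by case/or3P => /eqP->.
have hom (x y z x' y' z' : 'I_n) : x \in enum H -> y \in enum H -> z \in enum H ->
    x' \in enum H -> y' \in enum H -> z' \in enum H ->
    x < y < z -> x' < y' < z' -> col x y z = col x' y' z'.
  move=> xH yH zH xH' yH' zH' xyz xyz'; rewrite -!CE //.
  have c3 (u v t : 'I_n) : u < v < t -> #|[set r in [:: u; v; t]]| = 3.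
    by case/andP=> uv vt; rewrite cardE enum_set_sorted //= uv vt.
  by apply: homH; rewrite ?sub ?c3.
have [aH bH cH dH] : [/\ a \in enum H, b \in enum H, c \in enum H & d \in enum H].
  by rewrite eH !inE !eqxx !orbT.
have abc : a < b < c by rewrite ab.
have abd : a < b < d by rewrite ab.
have acd : a < c < d by rewrite ac.
have bcd : b < c < d by rewrite bc.
have e1 : w a b c = w a b d.
  have [+ _] := col_eq _ _ _ _ _ _ abc abd (hom _ _ _ _ _ _ aH bH cH aH bH dH abc abd).
  by apply: position_inj; case: (posP _ _ _ abc).
have e2 : w a b d = w a c d.
  have [_ +] := col_eq _ _ _ _ _ _ abd acd (hom _ _ _ _ _ _ aH bH dH aH cH dH abd acd).
  by apply: position_inj; case: (posP _ _ _ abd).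
have e3 : w a c d = w b c d.
  have [+ _] := col_eq _ _ _ _ _ _ acd bcd (hom _ _ _ _ _ _ aH cH dH bH cH dH acd bcd).
  by apply: position_inj; case: (posP _ _ _ acd).
(* The relation {b,d} < c is moved into the member [w a b c], where {a,c} < b already holds. *)
have := wP _ _ _ bcd; rewrite -e3 -e2 -e1.
by apply: ple_cycleF (wP _ _ _ abc);
  [apply: singleton_le_doubletonr | apply: singleton_le_doubletonl].
Qed.

Theorem theorem2p4 (s n : nat) :
  1 <= s -> Ram 3 4 (s ^ 2) <= n -> s < ldim1 2 n.
Proof.
(* Both minima are attained: [Ram] is itself a Ramsey bound, and [ldim] is the maximal multiplicity
   of some local realizer. *)
move=> _; rewrite /Ram; case: ex_minnP => N /asboolW[_ ram] _ /ram {}ram.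
rewrite /ldim1 /ldim; case: ex_minnP => k /asboolW[m [F [realF <-]]] _.
exact: max_mult_ramsey.
Qed.
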